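(* Let $\Gamma$ be a convex straight-line planar drawing of a Halin graph $G$ such that the internal edges form a tree. Then $\Gamma$ is a weighted barycenter drawing.
   Context: A Halin graph is a triconnected graph that consists of a tree, none of the vertices of which has exactly two neighbours, together with a cycle connecting the leaves of the tree, where the cycle connects the leaves in an order such that the resulting graph is planar. A straight-line planar drawing $\Gamma$ of $G=(V,E)$ is specified by a position $\gamma_i\in\mathbb{R}^2$ for each $i\in V$. It is convex if every face is a convex polygon; in particular the edges of the outer face $F_0$ form a simple convex polygon. A vertex is external if it lies on the outer face $F_0$ and internal otherwise. An edge is internal if it is incident to an internal vertex. $N(i)$ is the set of neighbours of $i$. The drawing $\Gamma$ is a weighted barycenter drawing if there is a real weight $w_{ij}=w_{ji}>0$ for each internal edge $(i,j)$ such that for each internal vertex $i$ $$\gamma_i=\frac{1}{\sum_{j\in N(i)} w_{ij}}\sum_{j\in N(i)} w_{ij}\gamma_j .$$ *)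

(* Defs.v *)
From mathcomp Require Import all_boot all_order all_algebra.
From mathcomp Require Import all_classical all_reals all_analysis.

Set Implicit Arguments.
Unset Strict Implicit.
Unset Printing Implicit Defensive.

Import Order.TTheory GRing.Theory Num.Theory.
Import numFieldNormedType.Exports.

Local Open Scope classical_set_scope.
Local Open Scope ring_scope.

Section Graphs.
Context {V : finType}.
Implicit Types (e t : rel V) (A : pred V) (S : {set V}).

Definition simple_graph e : Prop := symmetric e /\ irreflexive e.

Definition degree e (x : V) : nat := #|[pred y | e x y]|.

Definition delete_vertices e S : rel V :=
  [rel x y | [&& e x y, x \notin S & y \notin S]].

Definition triconnected e : Prop :=
  (3 < #|V|)%N /\
  forall S, (#|S| < 3)%N ->
  forall x y, x \notin S -> y \notin S -> connect (delete_vertices e S) x y.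

(* [ucycle t p] holds of the closed walks without repeated vertex; for a
   symmetric [t] those of size 2 merely go back and forth along an edge. *)
Definition acyclic t : Prop := forall p : seq V, ucycle t p -> (size p < 3)%N.

Definition tree_on A t : Prop :=
  [/\ simple_graph t, {in A &, forall x y, connect t x y} & acyclic t].

(* The graph formed by the edges of [t] is a tree: its vertices are the end
   points of these edges, the other elements of [V] being disregarded. *)
Definition edges_form_tree t : Prop := tree_on [pred x | [exists y, t x y]] t.

Definition cycle_adjacent (c : seq V) : rel V :=
  [rel x y | [&& x \in c, y \in c & (next c x == y) || (next c y == x)]].

End Graphs.

Section Drawings.
Context {R : realType} {V : finType}.
Local Notation plane := 'rV[R]_2.
Implicit Types (e : rel V) (g : V -> plane).

(* [arc x y], restricted to [0, 1], parametrises the curve representing the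
   edge {x, y} from [x] to [y]. *)
Definition planar_drawing e g (arc : V -> V -> R -> plane) : Prop :=
  [/\ injective g,
      forall x y, e x y ->
        [/\ {within `[0, 1], continuous (arc x y)},
            {in `[0, 1] &, injective (arc x y)},
            arc x y 0 = g x,
            arc x y 1 = g y &
            {in `[0, 1], forall s, arc y x s = arc x y (1 - s)}],
      forall x y z, e x y -> {in `]0, 1[, forall s, arc x y s <> g z} &
      forall x y z w, e x y -> e z w ->
        {in `]0, 1[ &, forall s s', arc x y s = arc z w s' ->
           (z, w) = (x, y) \/ (z, w) = (y, x)}].

Definition straight_arc g (x y : V) (s : R) : plane :=
  (1 - s) *: g x + s *: g y.

Definition straight_line_planar_drawing e g : Prop :=
  planar_drawing e g (straight_arc g).

Definition segment (a b : plane) : set plane :=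
  [set (1 - s) *: a + s *: b | s in `[0, 1]].

Definition drawing_points e g : set plane :=
  [set p | (exists x, p = g x) \/
           (exists x y, e x y /\ segment (g x) (g y) p)].

Definition face e g (F : set plane) : Prop :=
  exists2 p, ~ drawing_points e g p &
             F = connected_component (~` drawing_points e g) p.

Definition outer_face e g (F : set plane) : Prop :=
  face e g F /\ ~ bounded_set F.

Definition external e g (x : V) : Prop :=
  exists2 F, outer_face e g F & closure F (g x).

Definition internal e g (x : V) : Prop := ~ external e g x.

Definition internal_edge e g : rel V :=
  [rel x y | e x y && `[< internal e g x \/ internal e g y >]].

(* Twice the signed area of the triangle [a b c]; it is positive exactly when
   [c] lies strictly to the left of the line directed from [a] to [b]. *)
Definition orient (a b c : plane) : R :=
  (b 0 0 - a 0 0) * (c 0 1 - a 0 1) - (b 0 1 - a 0 1) * (c 0 0 - a 0 0).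

(* The corners are listed counterclockwise, and every corner lies strictly to
   the left of every side not containing it as an end point: the closed curve
   is simple and all its corners are genuine, with no flat angle. *)
Definition convex_polygon (p : seq plane) : Prop :=
  [/\ uniq p, (2 < size p)%N &
      {in p &, forall a b, b != a -> b != next p a ->
         0 < orient a (next p a) b}].

Definition polygon_sides (p : seq plane) : set plane :=
  \bigcup_(a in [set` p]) segment a (next p a).

Definition boundary (F : set plane) : set plane := closure F `\` interior F.

(* The corners of the polygon bounding a face are the vertices of the graph
   met along this face, and its sides are the edges. *)
Definition convex_drawing e g : Prop :=
  forall F, face e g F ->
  exists c : seq V,
    [/\ ucycle e c, convex_polygon (map g c) &
        boundary F = polygon_sides (map g c)].

Definition weighted_barycenter_drawing e g : Prop :=
  exists w : V -> V -> R,
    (forall x y, internal_edge e g x y -> w x y = w y x /\ 0 < w x y) /\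
    (forall x, internal e g x ->
       g x = (\sum_(y | e x y) w x y)^-1 *: \sum_(y | e x y) w x y *: g y).

End Drawings.

Definition planar (R : realType) (V : finType) (e : rel V) : Prop :=
  exists (g : V -> 'rV[R]_2) (arc : V -> V -> R -> 'rV[R]_2),
    planar_drawing e g arc.

(* The tree [t] spans all the vertices, and [c] lists its leaves in the order
   in which the additional cycle visits them. *)
Definition halin (R : realType) (V : finType) (e : rel V) : Prop :=
  [/\ simple_graph e, triconnected e, planar R e &
  exists (t : rel V) (c : seq V),
    [/\ tree_on predT t,
        forall x, degree t x <> 2%N,
        uniq c /\ (2 < size c)%N,
        forall x, (x \in c) = (degree t x == 1%N) &
        forall x y, e x y = t x y || cycle_adjacent c x y]].

(* Main.v *)
Require Import Defs.
From mathcomp Require Import all_boot all_order all_algebra.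
From mathcomp Require Import all_classical all_reals all_analysis.
From mathcomp Require Import ring lra.

(* If all the neighbours of an internal vertex x lay in a closed half plane
   bounded by a line through x, a half disc at x would be contained in a single
   face, which would have an angle of at least pi at x, against convexity.  By
   Stiemke's theorem in the plane, each internal x is thus a barycenter of its
   neighbours with positive coefficients a x y.  Multiplying the equation at x
   by a positive l x makes the coefficients symmetric as soon as
   l x * a x y = l y * a y x on the edges between internal vertices; as these
   edges form a forest, such l exists. *)

Set Implicit Arguments.
Unset Strict Implicit.
Unset Printing Implicit Defensive.

Import Order.TTheory GRing.Theory Num.Theory.
Import numFieldNormedType.Exports.

Local Open Scope classical_set_scope.
Local Open Scope ring_scope.

(** * Potentials with prescribed ratios along the edges of a forest *)

(** Induction on the number of oriented edges. Removing an edge separates its ends [u] and [v];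
    rescaling the potential on the component of [v] leaves the ratios along all remaining edges
    unchanged and can be tuned to fit the removed one. *)
Lemma forest_potential (R : numFieldType) (V : finType) (t : rel V)
    (r : V -> V -> R) :
  simple_graph t -> acyclic t ->
  (forall x y, t x y -> 0 < r x y) ->
  (forall x y, t x y -> r x y * r y x = 1) ->
  exists l : V -> R,
    (forall x, 0 < l x) /\ (forall x y, t x y -> l y = l x * r x y).
Proof.
have [n] := ubnP #|[pred p : V * V | t p.1 p.2]|.
elim: n t => // n IHn t t_lt [t_sym t_irr] t_ac r_gt0 r_inv.
have [/existsP[[u v] /= tuv]|no_edge] := boolP [exists p : V * V, t p.1 p.2];
  last first.
  exists (fun=> 1); split=> // x y txy; case/negP: no_edge.
  by apply/existsP; exists (x, y).
pose uv x y := (x == u) && (y == v) || (x == v) && (y == u).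
pose t' := [rel x y | t x y && ~~ uv x y].
have t't : subrel t' t by move=> x y /andP[].
have t'_sym : symmetric t'.
  move=> x y; rewrite /= t_sym /uv orbC.
  by rewrite [in X in _ || X]andbC [in X in X || _]andbC.
have t'_ac : acyclic t'.
  move=> p /andP[tp Up]; apply: t_ac; rewrite /ucycle Up andbT.
  exact: sub_cycle tp.
have [l [l_gt0 l_edge]] : exists l : V -> R,
    (forall x, 0 < l x) /\ (forall x y, t' x y -> l y = l x * r x y).
  apply: IHn => //.
  - apply: leq_trans (t_lt : (_ <= n)%N); apply: proper_card.
    rewrite properE; apply/andP; split.
      by apply/fintype.subsetP=> -[x y] /andP[].
    apply/fintype.subsetPn; exists (u, v); rewrite !inE //=.
    by rewrite /uv !eqxx andbF.
  - by split=> // x; rewrite /= t_irr.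
  - by move=> x y /t't; apply: r_gt0.
  - by move=> x y /t't; apply: r_inv.
(* A simple path from [v] to [u] closes up to a cycle of [t], so it has at most two vertices: one
   would make [tuv] a loop, two would make the path the removed edge itself. *)
have vu_disc : ~~ connect t' v u.
  apply/negP => /connectP[p tp]; case/shortenP: tp => q tq Uq _ def_u.
  have : ucycle t (v :: q).
    rewrite /ucycle Uq andbT /= rcons_path (sub_path t't tq) /=.
    by rewrite -def_u.
  move/t_ac; case: q tq Uq def_u => [|w [|//]] /=.
    by move=> _ _ def_u; rewrite def_u t_irr in tuv.
  by rewrite andbT => tw _ def_u; rewrite -def_u /uv !eqxx orbT andbF in tw.
have t'_csym : connect_sym t' by apply: sym_connect_sym.
(* The factor that turns the value at [v] into [l u * r u v]. *)
pose k := l u * r u v / l v.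
have k_gt0 : 0 < k by rewrite !mulr_gt0 ?invr_gt0 ?r_gt0.
exists (fun x => if connect t' v x then k * l x else l x); split.
  by move=> x; case: ifP => _ //; apply: mulr_gt0.
have lv : k * l v = l u * r u v by rewrite /k mulfVK // gt_eqF.
move=> x y txy; have [|nuv] := boolP (uv x y).
  case/orP=> /andP[/eqP-> /eqP->]; rewrite connect0 (negbTE vu_disc) //.
  by rewrite lv -mulrA r_inv ?mulr1.
have t'xy : t' x y by rewrite /= txy.
have cxy : connect t' x y by apply: connect1.
rewrite -(same_connect_r t'_csym cxy) (l_edge _ _ t'xy).
by case: ifP; rewrite // mulrA.
Qed.

(** * Stiemke's theorem in the plane *)

(* The vectors are (vx y, vy y) for y in A; [s] and [t] below are their
   coordinates along u and along u rotated by a right angle, times |u|.  If u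
   is outside the cone, the line through the vector with positive [t] that is
   closest in direction to u separates u from all of them. *)
Lemma plane_cone_full (R : realFieldType) (V : finType) (A : pred V)
    (vx vy : V -> R) (ux uy : R) :
  (forall dx dy, (forall y, A y -> 0 <= dx * vx y + dy * vy y) ->
     dx = 0 /\ dy = 0) ->
  exists c : V -> R,
    [/\ forall y, 0 <= c y, \sum_(y | A y) c y * vx y = ux &
        \sum_(y | A y) c y * vy y = uy].
Proof.
move=> no_sep.
have [[-> ->]|u_neq0] := pselect (ux = 0 /\ uy = 0).
  by exists (fun=> 0); split=> //; rewrite big1 // => y _; rewrite mul0r.
have uu_gt0 : 0 < ux ^+ 2 + uy ^+ 2.
  rewrite lt0r paddr_eq0 ?sqr_ge0 // !sqrf_eq0 addr_ge0 ?sqr_ge0 // andbT.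
  by apply/negP => /andP[/eqP ? /eqP ?]; apply: u_neq0.
pose s y := ux * vx y + uy * vy y.
pose t y := ux * vy y - uy * vx y.
have sum1 (z : V) (k : R) (f : V -> R) : A z ->
    \sum_(y | A y) (if y == z then k else 0) * f y = k * f z.
  move=> Az; rewrite (bigD1 z) //= eqxx big1 ?addr0 // => y /andP[_ /negbTE->].
  by rewrite mul0r.
have [[z [Az tz sz]]|no_z] := pselect (exists z, [/\ A z, t z = 0 & 0 < s z]).
  exists (fun y => if y == z then (ux ^+ 2 + uy ^+ 2) / s z else 0); split.
  - by move=> y; case: ifP => // _; rewrite divr_ge0 // ltW.
  - have E : (ux ^+ 2 + uy ^+ 2) * vx z = ux * s z - uy * t z
      by rewrite /s /t; ring.
    by rewrite sum1 // mulrAC E tz mulr0 subr0 mulfK ?gt_eqF.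
  - have E : (ux ^+ 2 + uy ^+ 2) * vy z = uy * s z + ux * t z
      by rewrite /s /t; ring.
    by rewrite sum1 // mulrAC E tz mulr0 addr0 mulfK ?gt_eqF.
(* Two vectors on opposite sides of the line of u, at an angle less than pi that contains u: the
   coefficients are given by Cramer's rule. *)
pose D n p := vx n * vy p - vy n * vx p.
have [[n [p [[An Ap] tn tp Dnp]]]|no_np] := pselect (exists n p,
    [/\ A n /\ A p, t n < 0, 0 < t p & 0 < D n p]).
  exists (fun y => (if y == n then t p / D n p else 0) +
                   (if y == p then - t n / D n p else 0)); split.
  - move=> y; apply: addr_ge0; case: ifP => // _;
      rewrite divr_ge0 ?(ltW Dnp) //.
      exact: ltW.
    by rewrite oppr_ge0 ltW.
  - under eq_bigr do rewrite mulrDl.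
    rewrite big_split /= !sum1 //.
    have := gt_eqF Dnp; rewrite /t /D => /negbT D0.
    by field.
  - under eq_bigr do rewrite mulrDl.
    rewrite big_split /= !sum1 //.
    have := gt_eqF Dnp; rewrite /t /D => /negbT D0.
    by field.
exfalso.
(* If [t] is never positive, the line of u itself separates: the functional is [- t]. *)
have [[p0 Ap0 tp0]|no_p] := pselect (exists2 p, A p & 0 < t p); last first.
  have [|uy0 ux0] := no_sep uy (- ux).
    move=> y Ay; have : ~ 0 < t y by move=> ty; apply: no_p; exists y.
    by move/negP; rewrite -leNgt /t; lra.
  by apply: u_neq0; lra.
have Pp0 : A p0 && (0 < t p0) by rewrite Ap0.
case: (@arg_maxP _ _ V p0 (fun p => A p && (0 < t p)) (fun p => s p / t p) Pp0).
move=> p /andP[Ap tp] p_max.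
pose m := s p / t p.
(* The functional is [m * t y - s y]. It is nonnegative by maximality of [m] if [t y] is positive,
   by [no_np] if it is negative, and by [no_z] if it is zero. *)
have [|d1 d2] := no_sep (- m * uy - ux) (m * ux - uy).
  move=> y Ay; suff: s y <= m * t y by rewrite /s /t; lra.
  case: (ltrgt0P (t y)) => ty.
  - by rewrite -ler_pdivrMr //; apply: p_max; rewrite Ay.
  - have : ~ 0 < D y p by move=> Dyp; apply: no_np; exists y, p.
    move/negP; rewrite -leNgt => Dyp.
    have sp : s p = m * t p by rewrite /m mulfVK // gt_eqF.
    rewrite -(ler_pM2r tp) -mulrA [t y * _]mulrC mulrA -sp -subr_ge0.
    have -> : s p * t y - s y * t p = (ux ^+ 2 + uy ^+ 2) * - D y p.
      by rewrite /s /t /D; ring.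
    by rewrite mulr_ge0 ?oppr_ge0 // ltW.
  - rewrite ty mulr0 leNgt; apply/negP => sy; apply: no_z; by exists y.
have : (ux ^+ 2 + uy ^+ 2) = 0.
  have -> : ux = - m * uy by lra.
  have -> : uy = 0; last by ring.
  have : (1 + m ^+ 2) * uy = 0.
    rewrite -[RHS]oppr0 -[in RHS]d2; have -> : ux = - m * uy by lra.
    by ring.
  move/eqP; rewrite mulf_eq0 => /orP[|/eqP//].
  by rewrite gt_eqF // ltr_pwDl // sqr_ge0.
by apply/eqP; rewrite gt_eqF.
Qed.

(** The opposite of each vector is a nonnegative combination of the vectors. Adding the vector to it
    gives a zero sum, and adding these relations up over [A] makes every coefficient at least 1. *)
Lemma positive_dependency (R : realFieldType) (V : finType) (A : pred V)
    (vx vy : V -> R) :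
  (forall dx dy, (forall y, A y -> 0 <= dx * vx y + dy * vy y) ->
     dx = 0 /\ dy = 0) ->
  exists a : V -> R,
    [/\ forall y, 0 < a y, \sum_(y | A y) a y * vx y = 0 &
        \sum_(y | A y) a y * vy y = 0].
Proof.
move=> no_sep.
have [c cP] := choice (fun y => plane_cone_full (- vx y) (- vy y) no_sep).
have sum_c (f : V -> R) : (forall y, \sum_(z | A z) c y z * f z = - f y) ->
    \sum_(z | A z) (1 + \sum_(y | A y) c y z) * f z = 0.
  move=> cf; under eq_bigr do rewrite mulrDl mul1r mulr_suml.
  rewrite big_split exchange_big /=.
  by under [X in _ + X]eq_bigr do rewrite cf; rewrite sumrN subrr.
exists (fun z => 1 + \sum_(y | A y) c y z); split.
- move=> z; rewrite ltr_pwDl // sumr_ge0 // => y _; by case: (cP y).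
- by apply: sum_c => y; case: (cP y).
- by apply: sum_c => y; case: (cP y).
Qed.

(** * Convex polygons and half discs *)

Lemma next_next_neq (T : eqType) (c : seq T) x :
  uniq c -> (2 < size c)%N -> x \in c ->
  next c x != x /\ next c (next c x) != x.
Proof.
move=> Uc c_gt2 xc; have [i c' def_c] := rot_to xc.
rewrite -!(next_rot i Uc) def_c.
move: c_gt2 Uc; rewrite -(size_rot i) -(rot_uniq i) def_c.
case: c' {def_c} => [|y [|z s]] //= _; rewrite eqxx !inE !negb_or.
move=> /andP[/and3P[xy xz _] _].
by rewrite (eq_sym y) (negbTE xy) eqxx (eq_sym z).
Qed.

Section Plane.
Context {R : realType}.
Local Notation plane := 'rV[R]_2.
Implicit Types (a b n p q x : plane) (c : seq plane) (F : set plane).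

Lemma plane_eq p q : p 0 0 = q 0 0 -> p 0 1 = q 0 1 -> p = q.
Proof.
move=> E0 E1; apply/rowP => -[[|[|//]] lti].
  by rewrite (_ : Ordinal lti = 0) //; apply: val_inj.
by rewrite (_ : Ordinal lti = 1) //; apply: val_inj.
Qed.

Lemma orient_affine a b p q (s : R) :
  orient a b ((1 - s) *: p + s *: q) =
  (1 - s) * orient a b p + s * orient a b q.
Proof. by rewrite /orient !mxE; ring. Qed.

Lemma orient_l a b : orient a b a = 0.
Proof. by rewrite /orient; ring. Qed.

Lemma orient_r a b : orient a b b = 0.
Proof. by rewrite /orient; ring. Qed.

Lemma affine_path_continuous a b :
  continuous (fun s : R => (1 - s) *: a + s *: b : plane).
Proof.
move=> s; apply: cvgD; apply: cvgZ; try exact: cvg_cst; last exact: cvg_id.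
by apply: cvgB; [exact: cvg_cst|exact: cvg_id].
Qed.

Lemma segment_connected_set a b : connected (segment a b).
Proof.
apply: connected_continuous_connected; first exact: segment_connected.
exact/continuous_subspaceT/affine_path_continuous.
Qed.

Lemma segment_closed a b : closed (segment a b).
Proof.
apply: compact_closed; first exact: norm_hausdorff.
apply: continuous_compact; last exact: segment_compact.
exact/continuous_subspaceT/affine_path_continuous.
Qed.

Lemma segmentl a b : segment a b a.
Proof.
exists 0; first by rewrite /= in_itv /= lexx ler01.
by rewrite subr0 scale1r scale0r addr0.
Qed.

Lemma segmentr a b : segment a b b.
Proof.
exists 1; first by rewrite /= in_itv /= lexx ler01.
by rewrite subrr scale1r scale0r add0r.
Qed.

Lemma segment_swap a b : segment a b `<=` segment b a.
Proof.
move=> p [s] /=; rewrite in_itv /= => /andP[s0 s1] <-; exists (1 - s) => /=.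
  by rewrite in_itv /= subr_ge0 s1 lerBlDr lerDl.
by rewrite addrC subKr.
Qed.

Lemma polygon_side_left c a p : convex_polygon c -> a \in c ->
  polygon_sides c p -> 0 <= orient a (next c a) p.
Proof.
move=> [_ _ left] ac; have left0 b : b \in c -> 0 <= orient a (next c a) b.
  move=> bc; have [->|ba] := eqVneq b a; first by rewrite orient_l.
  have [->|bn] := eqVneq b (next c a); first by rewrite orient_r.
  exact/ltW/left.
move=> [b /= bc] [s]; rewrite /= in_itv /= => /andP[s0 s1] <-.
rewrite orient_affine; apply: addr_ge0; apply: mulr_ge0 => //.
- by rewrite subr_ge0.
- exact: left0.
- by apply: left0; rewrite mem_next.
Qed.

(* A point of F strictly to the right of a side would send a ray from that
   side's corner away from the polygon; as F is bounded, the ray would leave F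
   and meet its boundary to the right of the side. *)
Lemma bounded_left_of_sides c F a q : convex_polygon c -> a \in c ->
  bounded_set F -> boundary F `<=` polygon_sides c -> F q ->
  0 <= orient a (next c a) q.
Proof.
move=> cvx ac bndF bdF Fq; rewrite leNgt; apply/negP => q_right.
set n := next c a in q_right.
have qa : q - a != 0.
  by rewrite subr_eq0; apply: contraTneq q_right => ->; rewrite orient_l ltxx.
pose ray (s : R) := (1 - s) *: a + s *: q.
pose S := [set s | 1 <= s /\ F (ray s)].
have S1 : S 1 by split; rewrite // /ray subrr scale0r scale1r add0r.
have S_sup : has_sup S.
  split; first by exists 1.
  have [M M_gt0 FM] := ex_strict_bound_gt0 bndF.
  exists ((M + `|a|) / `|q - a|) => s [s1 /FM /= ray_lt].
  rewrite ler_pdivlMr ?normr_gt0 //.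
  have -> : s * `|q - a| = `|ray s - a|.
    have -> : ray s - a = s *: (q - a).
      by rewrite /ray scalerBl scale1r scalerBr addrC !addrA addNr add0r addrC.
    by rewrite normrZ ger0_norm // (le_trans ler01).
  by apply: le_trans (ler_normB _ _) _; rewrite lerD2r ltW.
have sup1 : 1 <= sup S by exact: sup_upper_bound.
have ray_cont : {for sup S, continuous ray} by apply: affine_path_continuous.
(* The point at [sup S] is a limit of points of [F]; were it interior, [sup S + r / 2] would still
   belong to [S]. *)
have /bdF/(polygon_side_left cvx ac) : boundary F (ray (sup S)).
  split.
    move=> B /ray_cont.
    have := closure_sup (ex_intro _ _ S1) (proj2 S_sup).
    by move=> /[apply] -[s [[_ Fs] Bs]]; exists (ray s).
  move=> /ray_cont /nbhs_ballP [r /= r_gt0 rF].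
  have : S (sup S + r / 2).
    split; first by apply: le_trans sup1 _; rewrite lerDl divr_ge0 // ltW.
    apply: rF; rewrite -ball_normE /= opprD addrA subrr sub0r normrN.
    rewrite ger0_norm ?divr_ge0 ?(ltW r_gt0) // ltr_pdivrMr //.
    by rewrite ltr_pMr // ltr1n.
  move/(sup_upper_bound S_sup); rewrite gerDl leNgt divr_gt0 //.
rewrite orient_affine orient_l mulr0 add0r leNgt pmulr_rlt0 ?q_right //.
exact: lt_le_trans ltr01 sup1.
Qed.

Definition dot dx dy p : R := dx * p 0 0 + dy * p 0 1.

(** As [x] is on the line through [a] and [b], [orient a b] is a linear form in the displacement
    from [x]. By scaling it is nonnegative on an open half plane, so its kernel, which contains
    [b - a], is the line bounding that half plane. *)
Lemma half_disc_left a b x (dx dy r : R) : 0 < r ->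
  (forall p, `|p - x| < r -> dot dx dy (p - x) < 0 -> 0 <= orient a b p) ->
  orient a b x = 0 -> dx <> 0 \/ dy <> 0 -> dot dx dy (b - a) = 0.
Proof.
move=> r_gt0 half_left abx d_neq0.
have cross_ge0 z0 z1 : dx * z0 + dy * z1 < 0 ->
    0 <= (b 0 0 - a 0 0) * z1 - (b 0 1 - a 0 1) * z0.
  move=> z_neg; pose z : plane := \row_(i < 2) if i == 0 then z0 else z1.
  pose k := r / (`|z| + 1).
  have k_gt0 : 0 < k by rewrite divr_gt0 // ltr_wpDl.
  have : 0 <= orient a b (x + k *: z).
    apply: half_left; rewrite [x + _]addrC addrK.
      rewrite normrZ (gtr0_norm k_gt0) /k mulrAC ltr_pdivrMr ?ltr_wpDl //.
      by rewrite ltr_pM2l // ltrDl.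
    rewrite /dot !mxE /=.
    have -> : dx * (k * z0) + dy * (k * z1) = k * (dx * z0 + dy * z1) by ring.
    by rewrite pmulr_rlt0.
  have -> : orient a b (x + k *: z) = orient a b x +
      k * ((b 0 0 - a 0 0) * z1 - (b 0 1 - a 0 1) * z0).
    by rewrite /orient !mxE /=; ring.
  by rewrite abx add0r pmulr_rge0.
rewrite /dot !mxE.
set w0 := b 0 0 - _ in cross_ge0 *; set w1 := b 0 1 - _ in cross_ge0 *.
apply/eqP/negPn/negP => K0; set K := _ + _ in K0.
have dd_gt0 : 0 < dx ^+ 2 + dy ^+ 2.
  case: d_neq0 => /eqP; rewrite -sqrf_eq0 => d0.
    by rewrite ltr_pwDl ?sqr_ge0 // lt0r d0 sqr_ge0.
  by rewrite ltr_wpDl ?sqr_ge0 // lt0r d0 sqr_ge0.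
(* The test vector is [-d] plus [k] times d rotated by a right angle; it stays in the half plane for
   every [k], and this [k] gives the form the value -1. *)
pose k := (w0 * dy - w1 * dx - 1) / K.
have := cross_ge0 (- dx - k * dy) (- dy + k * dx).
have -> : dx * (- dx - k * dy) + dy * (- dy + k * dx) = - (dx ^+ 2 + dy ^+ 2).
  by ring.
rewrite oppr_lt0 => /(_ dd_gt0).
have -> : w0 * (- dy + k * dx) - w1 * (- dx - k * dy) =
    k * K - (w0 * dy - w1 * dx).
  by rewrite /K; ring.
by rewrite /k mulfVK //; lra.
Qed.

Lemma orient_orthogonal a b q (dx dy : R) : dx <> 0 \/ dy <> 0 ->
  dot dx dy (b - a) = 0 -> dot dx dy (q - a) = 0 -> orient a b q = 0.
Proof.
rewrite /dot /orient !mxE => d_neq0 ba ca.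
set b0 := b 0 0 - _ in ba *; set b1 := b 0 1 - _ in ba *.
set q0 := q 0 0 - _ in ca *; set q1 := q 0 1 - _ in ca *.
case: d_neq0 => /eqP d0; apply: (mulfI d0); rewrite mulr0.
  have -> : dx * (b0 * q1 - b1 * q0) =
    (dx * b0 + dy * b1) * q1 - (dx * q0 + dy * q1) * b1 by ring.
  by rewrite ba ca !mul0r subrr.
have -> : dy * (b0 * q1 - b1 * q0) =
  (dx * q0 + dy * q1) * b0 - (dx * b0 + dy * b1) * q0 by ring.
by rewrite ba ca !mul0r subrr.
Qed.

Lemma dot_affine dx dy a b x (s : R) :
  dot dx dy ((1 - s) *: a + s *: b - x) =
  (1 - s) * dot dx dy (a - x) + s * dot dx dy (b - x).
Proof. by rewrite /dot !mxE; ring. Qed.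

(* A face containing a half disc at a corner would have a flat or reflex angle
   there. *)
Lemma half_disc_not_corner c F x (dx dy r : R) : convex_polygon c -> x \in c ->
  bounded_set F -> boundary F `<=` polygon_sides c -> 0 < r ->
  (forall p, `|p - x| < r -> dot dx dy (p - x) < 0 -> F p) ->
  dx = 0 /\ dy = 0.
Proof.
move=> cvx xc bndF bdF r_gt0 half.
have [//|d_eq0] := pselect (dx = 0 /\ dy = 0).
have d_neq0 : dx <> 0 \/ dy <> 0.
  have [dx0|] := pselect (dx = 0); last by left.
  by right=> dy0; apply: d_eq0.
have [Uc c_gt2 left] := cvx.
pose n := next c x; pose b := prev c x.
have bc : b \in c by rewrite mem_prev.
have nb : next c b = x by rewrite next_prev.
have [nx nnx] := next_next_neq Uc c_gt2 xc.
have n_neq_b : n != b by apply: contra_neq nnx; rewrite -/n => ->; rewrite nb.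
(* Applied to both sides meeting at [x], this makes [b], [x] and [n] collinear, whereas [n] is
   strictly to the left of the side from [b] to [x]. *)
have sided a : a \in c -> orient a (next c a) x = 0 ->
    dot dx dy (next c a - a) = 0.
  move=> ac; move=> oax; apply: half_disc_left r_gt0 _ oax d_neq0 => p px dp.
  exact: bounded_left_of_sides cvx ac bndF bdF (half _ px dp).
have dn := sided x xc (orient_l _ _).
have := sided b bc; rewrite nb orient_r => /(_ erefl) db.
have := left b n bc; rewrite mem_next nb => /(_ xc n_neq_b nx).
rewrite (orient_orthogonal d_neq0 db) ?ltxx //.
have -> : dot dx dy (n - b) = dot dx dy (n - x) + dot dx dy (x - b).
  by rewrite /dot !mxE; ring.
by rewrite dn db addr0.
Qed.

(** * The drawing around an internal vertex *)

Section Graph.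
Context {V : finType} (e : rel V) (g : V -> plane).

(** The vertices other than [x] and the edges not incident to [x] are finitely many closed sets
    missing [g x], so some ball around [g x] avoids them all. *)
Lemma near_vertex_drawing_points (x : V) : symmetric e ->
  straight_line_planar_drawing e g ->
  exists2 r : R, 0 < r & forall p, `|p - g x| < r -> drawing_points e g p ->
    p = g x \/ exists2 y, e x y & segment (g x) (g y) p.
Proof.
move=> e_sym [g_inj _ vertex_off_arc _].
(* The case [y = z] treats a vertex as a degenerate segment. *)
pose avoid y z p :=
  y != x -> z != x -> y = z \/ e y z -> ~ segment (g y) (g z) p.
suff : \forall p \near g x, forall y z, avoid y z p.
  move=> /nbhs_ballP[r /= r_gt0 rP]; exists r => // p px.
  have far y z : avoid y z p.
    by apply: rP; rewrite -ball_normE /= distrC.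
  move=> [[y py]|[y [z [eyz pyz]]]].
    have [yx|yx] := eqVneq y x; first by left; rewrite py yx.
    by case: (far y y yx yx); [left|rewrite py; apply: segmentl].
  right; have [yx|yx] := eqVneq y x.
    by rewrite yx in eyz pyz; exists z.
  have [zx|zx] := eqVneq z x; last by case: (far y z yx zx); [right|].
  rewrite zx in eyz pyz; exists y; first by rewrite e_sym.
  exact: segment_swap.
have nbhs_x := nbhs_filter (g x).
apply: (@filter_forall _ _ (fun y p => forall z, avoid y z p) _ nbhs_x) => y.
apply: (@filter_forall _ _ (avoid y) _ nbhs_x) => z; rewrite /avoid.
have [->|yx] := eqVneq y x; first exact: filterE.
have [->|zx] := eqVneq z x; first by apply: filterE => p _.
have [eyz|neyz] := pselect (y = z \/ e y z); last exact: filterE.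
suff : nbhs (g x) (~` segment (g y) (g z)) by apply: filterS => p.
apply: open_nbhs_nbhs; split; first exact/closed_openC/segment_closed.
move=> [s] /=; rewrite in_itv /= => /andP[s0 s1] gx.
case: eyz => [yz|eyz].
  move: gx; rewrite yz -scalerDl subrK scale1r => /g_inj zx'.
  by rewrite zx' eqxx in zx.
have [s0'|s_neq0] := eqVneq s 0.
  move: gx; rewrite s0' subr0 scale1r scale0r addr0 => /g_inj yx'.
  by rewrite yx' eqxx in yx.
have [s1'|s_neq1] := eqVneq s 1.
  move: gx; rewrite s1' subrr scale1r scale0r add0r => /g_inj zx'.
  by rewrite zx' eqxx in zx.
apply: (vertex_off_arc y z x eyz s _ gx).
by rewrite in_itv /= !lt_neqAle s0 s1 s_neq1 eq_sym s_neq0.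
Qed.

Lemma segment_subset_half_disc x a b (dx dy r : R) :
  `|a - x| < r -> `|b - x| < r -> dot dx dy (a - x) < 0 ->
  dot dx dy (b - x) < 0 ->
  segment a b `<=` [set p | `|p - x| < r /\ dot dx dy (p - x) < 0].
Proof.
move=> ar br da db p [s] /=; rewrite in_itv /= => /andP[s0 s1] <-.
have s1' : 0 <= 1 - s by rewrite subr_ge0.
have convex_lt (u v w : R) : u < w -> v < w -> (1 - s) * u + s * v < w.
  move=> uw vw; have -> : w = (1 - s) * w + s * w by ring.
  have [->|s_neq0] := eqVneq s 0; first by rewrite !mul0r !addr0 subr0 !mul1r.
  by rewrite ler_ltD ?ler_wpM2l ?(ltW uw) // ltr_pM2l // lt0r s_neq0.
split; last by rewrite dot_affine; apply: convex_lt.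
have -> : (1 - s) *: a + s *: b - x = (1 - s) *: (a - x) + s *: (b - x).
  by apply: plane_eq; rewrite !mxE; ring.
apply: le_lt_trans (ler_normD _ _) _.
by rewrite !normrZ (ger0_norm s0) (ger0_norm s1'); apply: convex_lt.
Qed.

Lemma internal_neighbours_spread (x : V) (dx dy : R) : symmetric e ->
  straight_line_planar_drawing e g -> convex_drawing e g -> internal e g x ->
  (forall y, e x y -> 0 <= dot dx dy (g y - g x)) -> dx = 0 /\ dy = 0.
Proof.
move=> e_sym gP g_cvx x_int x_side.
have [//|d_eq0] := pselect (dx = 0 /\ dy = 0).
have [r r_gt0 near_x] := near_vertex_drawing_points x e_sym gP.
pose half := [set p | `|p - g x| < r /\ dot dx dy (p - g x) < 0].
have half_free : half `<=` ~` drawing_points e g.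
  move=> p [px dp] /(near_x p px) [pE|[y exy [s]]].
    by move: dp; rewrite pE subrr /dot !mxE !mulr0 addr0 ltxx.
  rewrite /= in_itv /= => /andP[s0 _] pE; move: dp; rewrite -pE dot_affine.
  rewrite subrr [X in _ * X + _](_ : _ = 0) ?mulr0 ?add0r; last first.
    by rewrite /dot !mxE !mulr0 addr0.
  by rewrite ltNge mulr_ge0 ?x_side.
pose d : plane := \row_(i < 2) if i == 0 then dx else dy.
have dd_gt0 : 0 < dx ^+ 2 + dy ^+ 2.
  rewrite lt0r paddr_eq0 ?sqr_ge0 // !sqrf_eq0 addr_ge0 ?sqr_ge0 // andbT.
  by apply/negP => /andP[/eqP ? /eqP ?]; apply: d_eq0.
(* Points of the half disc arbitrarily close to [g x], found by moving from it along [- d]: they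
   give a base point for the face and show that [g x] is in its closure. *)
have half_near (r' : R) : 0 < r' -> r' <= r ->
    exists2 p, half p & `|p - g x| < r'.
  move=> r'_gt0 r'r; pose k := r' / (`|d| + 1).
  have k_gt0 : 0 < k by rewrite divr_gt0 // ltr_wpDl.
  have kd : `|(g x - k *: d) - g x| < r'.
    rewrite addrAC subrr sub0r normrN normrZ (gtr0_norm k_gt0) /k mulrAC.
    by rewrite ltr_pdivrMr ?ltr_wpDl // ltr_pM2l // ltrDl.
  exists (g x - k *: d) => //; split; first exact: lt_le_trans r'r.
  rewrite /dot !mxE /=.
  have -> : dx * (g x 0 0 - k * dx - g x 0 0) +
      dy * (g x 0 1 - k * dy - g x 0 1) = - (k * (dx ^+ 2 + dy ^+ 2)) by ring.
  by rewrite oppr_lt0 mulr_gt0.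
have [p0 half_p0 _] := half_near r r_gt0 (lexx r).
pose F := connected_component (~` drawing_points e g) p0.
have half_F : half `<=` F.
  move=> p half_p; apply: (@connected_component_max _ _ (segment p0 p)).
  - exact: segmentl.
  - move=> q p0pq; apply: half_free; move: q p0pq.
    by apply: segment_subset_half_disc; case: half_p; case: half_p0.
  - exact: segment_connected_set.
  - exact: segmentr.
have F_face : face e g F by exists p0; first exact: half_free.
have x_clF : closure F (g x).
  move=> B /nbhs_ballP[r' /= r'_gt0 r'B].
  have [||p half_p px] := half_near (Num.min r' r).
  - by rewrite lt_min r'_gt0.
  - by rewrite ge_min lexx orbT.
  exists p; split; first exact: half_F.
  apply: r'B; rewrite -ball_normE /= distrC.
  by apply: lt_le_trans px _; rewrite ge_min lexx.
(* An unbounded [F] would be an outer face with [g x] in its closure, making [x] external. *)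
have F_bnd : bounded_set F.
  by apply: contrapT => F_unb; apply: x_int; exists F.
have x_bdF : boundary F (g x).
  split=> //; move=> /nbhs_singleton/connected_component_sub; apply.
  by left; exists x.
have [c [/andP[ec Uc] c_cvx bdF]] := g_cvx F F_face.
have [g_inj _ vertex_off_arc _] := gP.
(* [g x] lies on a side of the polygon, and no vertex lies in the relative interior of an edge. *)
have xc : x \in c.
  move: x_bdF; rewrite bdF => -[_ /= /mapP[a ac ->]].
  rewrite next_map // => -[s] /=; rewrite in_itv /= => /andP[s0 s1] gx.
  have [s0'|s_neq0] := eqVneq s 0.
    by move: gx; rewrite s0' subr0 scale1r scale0r addr0 => /g_inj <-.
  have [s1'|s_neq1] := eqVneq s 1.
    move: gx; rewrite s1' subrr scale1r scale0r add0r => /g_inj <-.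
    by rewrite mem_next.
  case: (vertex_off_arc a (next c a) x (next_cycle ec ac) s _ gx).
  by rewrite in_itv /= !lt_neqAle s0 s1 s_neq1 eq_sym s_neq0.
apply: (half_disc_not_corner c_cvx _ F_bnd _ r_gt0).
- exact: map_f xc.
- by rewrite bdF.
- by move=> p px dp; apply: half_F.
Qed.
End Graph.
End Plane.

(** * Symmetric weights from the local ones *)

Theorem corollary3 (R : realType) (V : finType) (e : rel V)
    (g : V -> 'rV[R]_2)
    (e_halin : halin R e)
    (g_planar : straight_line_planar_drawing e g)
    (g_convex : convex_drawing e g)
    (internal_tree : edges_form_tree (internal_edge e g)) :
  weighted_barycenter_drawing e g.
Proof.
have [[e_sym e_irr] _ _ _] := e_halin.
have [_ _ t_acyclic] := internal_tree.
have local_weights x : exists a : V -> R, internal e g x ->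
    [/\ forall y, 0 < a y, \sum_(y | e x y) a y *: (g y - g x) = 0 &
        0 < \sum_(y | e x y) a y].
  have [x_int|] := pselect (internal e g x); last by exists (fun=> 0).
  have spread dx dy := @internal_neighbours_spread R V e g x dx dy e_sym
    g_planar g_convex x_int.
  have [|a [a_gt0 sum0 sum1]] := @positive_dependency R V (e x)
      (fun y => g y 0 0 - g x 0 0) (fun y => g y 0 1 - g x 0 1).
    move=> dx dy d_ge0; apply: spread => y exy.
    by have := d_ge0 y exy; rewrite /dot !mxE.
  exists a => _; split=> //.
    apply: plane_eq; rewrite summxE [RHS]mxE.
      by rewrite -[RHS]sum0; apply: eq_bigr => y _; rewrite !mxE.
    by rewrite -[RHS]sum1; apply: eq_bigr => y _; rewrite !mxE.
  (* Without neighbours, the spread condition would hold vacuously for the direction (1, 0). *)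
  have [y exy|no_edge] := pickP (e x).
    by rewrite (bigD1 y) //= ltr_pwDl // sumr_ge0 // => z _; apply: ltW.
  have [|/eqP] := spread 1 0; first by move=> y; rewrite no_edge.
  by rewrite oner_eq0.
have [a aP] := choice local_weights.
(* An opaque boolean form of [internal], on which conversion stays cheap. *)
have [inner innerP] : exists inner : pred V,
    forall x, internal e g x <-> inner x.
  by exists (fun x => `[< internal e g x >]); move=> x; rewrite asboolE.
have a_gt0 x y : inner x -> 0 < a x y by move=> /innerP/aP[].
(* Only edges with both ends internal occur in two barycenter equations and so constrain the
   scaling. *)
pose t := [rel x y | [&& e x y, inner x & inner y]].
have t_sym : symmetric t by move=> x y; rewrite /= e_sym [inner x && _]andbC.
have [||||l [l_gt0 l_edge]] :=
    @forest_potential R V t (fun x y => a x y / a y x).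
- by split=> // x; rewrite /= e_irr.
- move=> p /andP[tp Up]; apply: t_acyclic; rewrite /ucycle Up andbT.
  apply: sub_cycle tp => x y /and3P[exy /innerP x_int _].
  by rewrite /internal_edge /= exy; apply/asboolP; left.
- by move=> x y /and3P[_ x_int y_int]; rewrite divr_gt0 ?a_gt0.
- move=> x y /and3P[_ x_int y_int].
  by rewrite mulrA mulfVK ?divff // gt_eqF ?a_gt0.
(* At an external [x] the weight is read off the equation at [y]; if both ends are internal,
   [l_edge] makes the two expressions agree. *)
pose w x y := if inner x then l x * a x y else l y * a y x.
exists w; split.
  move=> x y /andP[exy /asboolP xy_int]; rewrite /w.
  have [x_int|x_ext] := boolP (inner x).
    split; last by rewrite mulr_gt0 ?a_gt0.
    case: ifP => // y_int; rewrite (l_edge x y) /= ?exy ?x_int ?y_int //.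
    by rewrite mulrA mulfVK // gt_eqF ?a_gt0.
  have y_int : inner y by case: xy_int => /innerP //; rewrite (negbTE x_ext).
  by rewrite y_int mulr_gt0 ?a_gt0.
move=> x x_int; have [_ sum0 sum_gt0] := aP x x_int.
move/innerP in x_int.
have -> : \sum_(y | e x y) w x y = l x * \sum_(y | e x y) a x y.
  by rewrite mulr_sumr; apply: eq_bigr => y _; rewrite /w x_int.
have -> : \sum_(y | e x y) w x y *: g y =
    (l x * \sum_(y | e x y) a x y) *: g x.
  rewrite -scalerA scaler_suml.
  have -> : \sum_(y | e x y) a x y *: g x = \sum_(y | e x y) a x y *: g y.
    apply/esym/eqP; rewrite -subr_eq0 -sumrB -[X in _ == X]sum0; apply/eqP.
    by apply: eq_bigr => y _; rewrite scalerBr.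
  rewrite scaler_sumr; apply: eq_bigr => y _.
  by rewrite /w x_int scalerA.
by rewrite scalerA mulVf ?scale1r // mulf_neq0 ?gt_eqF.
Qed.
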